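(* Let $\Omega_c$ be a commutative semigroup and let $(A,\prec_{\omega_1,\omega_2},\succ_{\omega_1,\omega_2},\Omega_c)$ be an $\Omega_c$-relative pre-anti-flexible algebra. Then the products $$x\circledast_{\alpha,\beta}y = x\prec_{\alpha,\beta}y + x\succ_{\alpha,\beta}y\qquad(x,y\in A,\ \alpha,\beta\in\Omega_c)$$ endow $A$ with an $\Omega_c$-relative anti-flexible algebra structure.
   Context: Standing conventions: $\Omega_c$ is a commutative associative semigroup; $A$ is a finite-dimensional vector space over a field of characteristic zero; all operations on $A$ are bilinear. An $\Omega_c$-relative pre-anti-flexible algebra is a vector space $A$ with bilinear operations $\prec_{\alpha,\beta},\succ_{\alpha,\beta}:A\times A\to A$ for each $(\alpha,\beta)\in\Omega_c^2$ such that for all $x,y,z\in A$ and $\alpha,\beta,\gamma\in\Omega_c$: $$(x\succ_{\alpha,\beta}y)\prec_{\alpha\beta,\gamma}z - x\succ_{\alpha,\beta\gamma}(y\prec_{\beta,\gamma}z) = (z\succ_{\gamma,\beta}y)\prec_{\gamma\beta,\alpha}x - z\succ_{\gamma,\beta\alpha}(y\prec_{\beta,\alpha}x),$$ $$(x\prec_{\alpha,\beta}y + x\succ_{\alpha,\beta}y)\succ_{\alpha\beta,\gamma}z - x\succ_{\alpha,\beta\gamma}(y\succ_{\beta,\gamma}z) = (z\prec_{\gamma,\beta}y)\prec_{\gamma\beta,\alpha}x - z\prec_{\gamma,\beta\alpha}(y\prec_{\beta,\alpha}x + y\succ_{\beta,\alpha}x).$$ An $\Omega_c$-relative anti-flexible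 algebra is a vector space $A$ with bilinear operations $\cdot_{\alpha,\beta}:A\times A\to A$ for each $(\alpha,\beta)\in\Omega_c^2$ such that for all $x,y,z\in A$ and $\alpha,\beta,\gamma\in\Omega_c$: $$(x\cdot_{\alpha,\beta}y)\cdot_{\alpha\beta,\gamma}z - x\cdot_{\alpha,\beta\gamma}(y\cdot_{\beta,\gamma}z) = (z\cdot_{\gamma,\beta}y)\cdot_{\gamma\beta,\alpha}x - z\cdot_{\gamma,\beta\alpha}(y\cdot_{\beta,\alpha}x).$$ *)

(* Defs.v *)
From mathcomp Require Import all_boot all_order all_algebra all_fingroup.

Set Implicit Arguments.
Unset Strict Implicit.
Unset Printing Implicit Defensive.

Import GRing.Theory.
Local Open Scope ring_scope.

(* [mul a b x y] is the product of x and y with index (a, b). *)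
Definition bilinear_family (Omega : Type) (F : fieldType) (A : lmodType F)
    (mul : Omega -> Omega -> A -> A -> A) : Prop :=
  forall a b : Omega, bilinear_for *:%R *:%R (mul a b).

Record relative_anti_flexible (Omega : semigroupType) (F : fieldType)
    (A : lmodType F) (mul : Omega -> Omega -> A -> A -> A) : Prop := {
  raf_bilinear : bilinear_family mul;
  raf_assoc : forall (a b c : Omega) (x y z : A),
    mul (a * b)%g c (mul a b x y) z - mul a (b * c)%g x (mul b c y z)
    = mul (c * b)%g a (mul c b z y) x - mul c (b * a)%g z (mul b a y x)
}.

Record relative_pre_anti_flexible (Omega : semigroupType) (F : fieldType)
    (A : lmodType F) (prec succ : Omega -> Omega -> A -> A -> A) : Prop := {
  rpaf_prec_bilinear : bilinear_family prec;
  rpaf_succ_bilinear : bilinear_family succ;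
  rpaf_middle : forall (a b c : Omega) (x y z : A),
    prec (a * b)%g c (succ a b x y) z - succ a (b * c)%g x (prec b c y z)
    = prec (c * b)%g a (succ c b z y) x - succ c (b * a)%g z (prec b a y x);
  rpaf_outer : forall (a b c : Omega) (x y z : A),
    succ (a * b)%g c (prec a b x y + succ a b x y) z
      - succ a (b * c)%g x (succ b c y z)
    = prec (c * b)%g a (prec c b z y) x
      - prec c (b * a)%g z (prec b a y x + succ b a y x)
}.

(* Main.v *)
(** Expanding the associator of the sum of [prec] and [succ] by bilinearity
    gives three pieces: an outer left one, a middle one and an outer right one.
    Reversing [(x, y, z)] fixes the middle piece (first axiom) and exchanges the
    two outer ones (second axiom), so their sum is invariant. *)
Require Import Defs.
From mathcomp Require Import all_boot all_order all_algebra all_fingroup.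

Set Implicit Arguments.
Unset Strict Implicit.

Import GRing.Theory.

Local Open Scope ring_scope.

Section BilinearFamily.
Variables (Omega : Type) (F : fieldType) (A : lmodType F).
Implicit Types (mul : Omega -> Omega -> A -> A -> A) (a b : Omega) (x y z : A).

Lemma bilinear_familyDl mul : bilinear_family mul ->
  forall a b x y z, mul a b (x + y) z = mul a b x z + mul a b y z.
Proof.
(* Linearity is stated for [k *: u + v]; the scalar 1 extracts additivity. *)
by move=> mul_bil a b x y z; have [+ _] := mul_bil a b => /(_ z 1 x y); rewrite /= !scale1r.
Qed.

Lemma bilinear_familyDr mul : bilinear_family mul ->
  forall a b x y z, mul a b x (y + z) = mul a b x y + mul a b x z.
Proof.
by move=> mul_bil a b x y z; have [_ +] := mul_bil a b => /(_ x 1 y z); rewrite /= !scale1r.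
Qed.

Lemma bilinear_familyD mul1 mul2 :
    bilinear_family mul1 -> bilinear_family mul2 ->
  bilinear_family (fun a b x y => mul1 a b x y + mul2 a b x y).
Proof.
move=> bil1 bil2 a b.
have [lin1l lin1r] := bil1 a b; have [lin2l lin2r] := bil2 a b.
split=> u k v w /=.
  by have /= -> := lin1l u k v w; have /= -> := lin2l u k v w; rewrite scalerDr addrACA.
by have /= -> := lin1r u k v w; have /= -> := lin2r u k v w; rewrite scalerDr addrACA.
Qed.

End BilinearFamily.

(** Only [prec] of a sum on the left and [succ] of a sum on the right are expanded; the other two
    occurrences of [mul] stay whole, so that each piece is literally one side of an axiom. *)
Lemma sum_associatorE (Omega : semigroupType) (F : fieldType) (A : lmodType F)
    (prec succ : Omega -> Omega -> A -> A -> A)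
    (mul := fun a b x y => prec a b x y + succ a b x y) :
    bilinear_family prec -> bilinear_family succ ->
  forall (a b c : Omega) (x y z : A),
    mul (a * b)%g c (mul a b x y) z - mul a (b * c)%g x (mul b c y z)
    = (prec (a * b)%g c (prec a b x y) z - prec a (b * c)%g x (mul b c y z))
      + (prec (a * b)%g c (succ a b x y) z - succ a (b * c)%g x (prec b c y z))
      + (succ (a * b)%g c (mul a b x y) z - succ a (b * c)%g x (succ b c y z)).
Proof.
move=> prec_bil succ_bil a b c x y z; rewrite /mul.
rewrite (bilinear_familyDl prec_bil) (bilinear_familyDr succ_bil).
by rewrite addrA !opprD [LHS]addrACA [X in X + _ = _]addrACA.
Qed.

Theorem proposition3p3 (F : fieldType) (charF0 : [pchar F] =i pred0)
    (A : vectType F) (Omega : semigroupType)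
    (mulOmegaC : forall a b : Omega, (a * b)%g = (b * a)%g)
    (prec succ : Omega -> Omega -> A -> A -> A)
    (preA : relative_pre_anti_flexible prec succ) :
  relative_anti_flexible
    (fun (a b : Omega) (x y : A) => prec a b x y + succ a b x y).
Proof.
have [prec_bil succ_bil middle outer] := preA.
split=> [|a b c x y z]; first exact: bilinear_familyD.
rewrite !(sum_associatorE prec_bil succ_bil) middle outer.
(* The outer left piece at [(x, y, z)] is the right side of [outer] at the reversed triple, hence
   the backward use. Both sides then have the same three terms, in opposite orders. *)
by rewrite -(outer c b a z y x) addrC addrA addrAC.
Qed.
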